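(* Let $G$ be a metrizable abelian topological group, and let $\hat{G}$ be its dual group, i.e. the group of continuous homomorphisms $G\to\mathbb{T}$ endowed with the compact-open topology. If $\hat{G}$ is strongly sequential, then $\hat{G}$ is metrizable and locally compact.
   Context: $\mathbb{T}$ denotes the one-dimensional torus (circle group). Two families $\mathcal{A},\mathcal{B}$ of subsets of a set $X$ mesh, written $\mathcal{A}\#\mathcal{B}$, if $A\cap B\neq\varnothing$ for all $A\in\mathcal{A}$, $B\in\mathcal{B}$. A sequence $(x_n)_{n\in\omega}$ is identified with the filter generated by its tails, so $\mathcal{H}\#(x_n)_{n}$ means $H\cap\{x_n:n\ge k\}\neq\varnothing$ for every $H\in\mathcal{H}$ and $k\in\omega$. A filter is countably based if it has a countable filter base; $\mathbb{F}_1$ denotes the class of countably based filters. For a filter $\mathcal{H}$ on a topological space $X$: the adherence is $\mathrm{adh}\,\mathcal{H}:=\bigcap_{H\in\mathcal{H}}\mathrm{cl}\,H$; the sequential adherence is $\mathrm{adh}_{\mathrm{Seq}}\mathcal{H}:=\bigcup_{(x_n)_n\#\mathcal{H}}\lim (x_n)_n$, i.e. the set of all limits of convergent sequences meshing with $\mathcal{H}$. For $A\subseteq X$, $\mathrm{cl}_{\mathrm{Seq}}A$ denotes the closure of $A$ in the coarsest sequential topology finer than the topology of $X$ (the topology whose closed sets are the sequentially closed subsets of $X$). A $T_1$ topological space $X$ is strongly sequential if $\mathrm{adh}\,\mathcal{H}\subseteq \mathrm{cl}_{\mathrm{Seq}}(\mathrm{adh}_{\mathrm{Seq}}\mathcal{H})$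 for every countably based filter $\mathcal{H}$ on $X$; equivalently, for every filter $\mathcal{F}$ on $X$, $\lim\mathcal{F}=\bigcap_{\mathcal{H}\in\mathbb{F}_1,\ \mathcal{H}\#\mathcal{F}}\mathrm{cl}_{\mathrm{Seq}}(\mathrm{adh}_{\mathrm{Seq}}\mathcal{H})$. *)

(* Defs.v *)
From HB Require Import structures.
From mathcomp Require Import all_boot all_order all_algebra.
From mathcomp Require Import complex.
From mathcomp Require Import all_classical all_reals all_analysis.

Set Implicit Arguments.
Unset Strict Implicit.
Unset Printing Implicit Defensive.

Import Order.TTheory GRing.Theory Num.Theory.
Import numFieldNormedType.Exports.

Local Open Scope classical_set_scope.
Local Open Scope ring_scope.
Local Open Scope complex_scope.

Section Torus.
Context (R : realType).

Definition unit_complex : set R[i]^o := [set z | `|z| = 1].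

(* The topology is the subspace topology of R[i]. The group law is complex
   multiplication, written additively so as to get a topologicalZmodType. *)
Definition torus : Type := set_type unit_complex.

HB.instance Definition _ := Choice.on torus.
HB.instance Definition _ := Topological.on torus.

Lemma torus_norm (z : torus) : `|set_val z| = 1 :> R[i].
Proof. exact: set_valP z. Qed.

Definition torus_of (z : R[i]) (hz : `|z| = 1) : torus :=
  SigSub (mem_set hz : z \in unit_complex).

Fact torus0_subproof : `|1| = 1 :> R[i].
Proof. exact: normr1. Qed.

Fact torusD_subproof (z w : torus) : `|set_val z * set_val w| = 1 :> R[i].
Proof. by rewrite normrM !torus_norm mulr1. Qed.

Fact torusN_subproof (z : torus) : `|(set_val z : R[i])^-1| = 1 :> R[i].
Proof. by rewrite normfV torus_norm invr1. Qed.

Definition torus0 : torus := torus_of torus0_subproof.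
Definition torusD (z w : torus) : torus := torus_of (torusD_subproof z w).
Definition torusN (z : torus) : torus := torus_of (torusN_subproof z).

Fact torusDA : associative torusD.
Proof. by move=> x y z; apply: val_inj; exact: mulrA. Qed.

Fact torusDC : commutative torusD.
Proof. by move=> x y; apply: val_inj; exact: mulrC. Qed.

Fact torus0D : left_id torus0 torusD.
Proof. by move=> x; apply: val_inj; exact: mul1r. Qed.

Fact torus_neq0 (z : torus) : set_val z != 0 :> R[i].
Proof. by rewrite -normr_gt0 torus_norm ltr01. Qed.

Fact torusND : left_inverse torus0 torusN torusD.
Proof. by move=> x; apply: val_inj; exact: mulVf (torus_neq0 x). Qed.

HB.instance Definition _ :=
  GRing.isZmodule.Build torus torusDA torusDC torus0D torusND.

Fact torus_val_continuous : continuous (set_val : torus -> R[i]^o).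
Proof. exact: initial_continuous. Qed.

Fact continuous_to_torus (X : topologicalType) (f : X -> torus) :
  continuous (set_val \o f : X -> R[i]^o) -> continuous f.
Proof.
move=> cf; apply/continuousP => A [B oB <-].
by rewrite -comp_preimage; move/continuousP: cf; apply.
Qed.

Fact torus_add_continuous : continuous (fun z : torus * torus => z.1 + z.2).
Proof.
apply: continuous_to_torus => z.
apply: (@cvgM R[i] _ _ _ (fun x : torus * torus => set_val x.1 : R[i])
  (fun x : torus * torus => set_val x.2 : R[i])).
  by apply: (cvg_comp _ _ cvg_fst); exact: torus_val_continuous.
by apply: (cvg_comp _ _ cvg_snd); exact: torus_val_continuous.
Qed.

Fact torus_opp_continuous : continuous (-%R : torus -> torus).
Proof.
apply: continuous_to_torus => z.
have /(_ (torus_neq0 z)) := @inv_continuous R[i] (set_val z).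
by apply: continuous_comp; exact: torus_val_continuous.
Qed.

HB.instance Definition _ :=
  PreTopologicalNmodule_isTopologicalNmodule.Build torus torus_add_continuous.
HB.instance Definition _ :=
  TopologicalNmodule_isTopologicalZmodule.Build torus torus_opp_continuous.

End Torus.

Section DualGroup.
Context (R : realType) (G : topologicalZmodType).

Definition characters : set {compact-open, G -> torus R} :=
  [set f | continuous (f : G -> torus R) /\
           {morph (f : G -> torus R) : x y / x + y}].

(* As a subtype of {compact-open, G -> torus R}, the dual group carries the
   subspace topology of the compact-open topology. *)
Definition dual : Type := set_type characters.

HB.instance Definition _ := Choice.on dual.
HB.instance Definition _ := Topological.on dual.

Definition dual_fun (f : dual) : G -> torus R := set_val f.

Lemma dual_continuous (f : dual) : continuous (dual_fun f).
Proof. by case: (set_valP f). Qed.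

Lemma dual_morph (f : dual) : {morph dual_fun f : x y / x + y}.
Proof. by case: (set_valP f). Qed.

Definition dual_of (f : G -> torus R) (cf : continuous f)
    (mf : {morph f : x y / x + y}) : dual :=
  SigSub (mem_set (conj cf mf) : (f : {compact-open, G -> torus R})
                                   \in characters).

Fact dual0_continuous : continuous ((fun=> 0) : G -> torus R).
Proof. by move=> x; exact: cvg_cst. Qed.

Fact dual0_morph : {morph ((fun=> 0) : G -> torus R) : x y / x + y}.
Proof. by move=> x y; rewrite addr0. Qed.

Fact dualD_continuous (f g : dual) :
  continuous (fun x => dual_fun f x + dual_fun g x).
Proof.
move=> x; apply: (@continuous2_cvg _ _ _ _ _ _ _ _ (fun z w => z + w)).
- exact: (@torus_add_continuous R (dual_fun f x, dual_fun g x)).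
- exact: dual_continuous.
- exact: dual_continuous.
Qed.

Fact dualD_morph (f g : dual) :
  {morph (fun x => dual_fun f x + dual_fun g x) : x y / x + y}.
Proof. by move=> x y; rewrite !dual_morph addrACA. Qed.

Fact dualN_continuous (f : dual) : continuous (fun x => - dual_fun f x).
Proof.
move=> x; apply: continuous_comp; first exact: dual_continuous.
exact: torus_opp_continuous.
Qed.

Fact dualN_morph (f : dual) : {morph (fun x => - dual_fun f x) : x y / x + y}.
Proof. by move=> x y; rewrite dual_morph opprD. Qed.

Definition dual0 : dual := dual_of dual0_continuous dual0_morph.
Definition dualD (f g : dual) : dual :=
  dual_of (@dualD_continuous f g) (@dualD_morph f g).
Definition dualN (f : dual) : dual :=
  dual_of (@dualN_continuous f) (@dualN_morph f).

Fact dualDA : associative dualD.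
Proof. by move=> f g h; apply/val_inj/funext => x; exact: addrA. Qed.

Fact dualDC : commutative dualD.
Proof. by move=> f g; apply/val_inj/funext => x; exact: addrC. Qed.

Fact dual0D : left_id dual0 dualD.
Proof. by move=> f; apply/val_inj/funext => x; exact: add0r. Qed.

Fact dualND : left_inverse dual0 dualN dualD.
Proof. by move=> f; apply/val_inj/funext => x; exact: addNr. Qed.

HB.instance Definition _ :=
  GRing.isZmodule.Build dual dualDA dualDC dual0D dualND.

End DualGroup.

Definition metrizable (R : realType) (X : topologicalType) : Prop :=
  exists d : X -> X -> R,
    [/\ forall x y, 0 <= d x y,
        forall x y, d x y = 0 <-> x = y,
        forall x y, d x y = d y x,
        forall x y z, d x z <= d x y + d y z &
        forall x, nbhs x = filter_from [set e : R | 0 < e]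
                                       (fun e => [set y | d x y < e])].

Section SequentialModification.
Context (X : topologicalType).

Definition seq_closed (F : set X) : Prop :=
  forall (u : nat -> X) (x : X),
    (forall n, F (u n)) -> u @ \oo --> x -> F x.

(* X with the coarsest sequential topology finer than its own: the closed sets
   are the sequentially closed subsets of X. *)
Definition sequentialization : Type := X.

Definition seq_open (U : set sequentialization) : Prop := seq_closed (~` U).

Fact seq_openT : seq_open setT.
Proof. by move=> u x /(_ 0%N); rewrite setCT. Qed.

Fact seq_openI : setI_closed seq_open.
Proof.
move=> A B oA oB u x uAB ux; apply: contrapT => /contrapT [Ax Bx].
have sub (m : nat -> nat) : (forall n, (n <= m n)%N) -> (u \o m) @ \oo --> x.
  move=> hm; apply: cvg_comp ux => P [N _ NP]; exists N => // n /= Nn.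
  by apply: NP => /=; exact: leq_trans Nn (hm n).
have [hA|/existsNP[N hN]] :=
    pselect (forall n, exists m, (n <= m)%N /\ (~` A) (u m)).
  have /choice[m hm] := hA.
  by apply: (oA (u \o m) x) => // [n|]; [case: (hm n)|apply: sub => n; case: (hm n)].
apply: (oB (u \o addn N) x) => // [n|]; last by apply: sub => n; exact: leq_addl.
move=> Bu; apply: (uAB (N + n)%N); split=> //.
by apply: contrapT => nA; apply: hN; exists (N + n)%N; split; [exact: leq_addr|].
Qed.

Fact seq_open_bigU (I : Type) (f : I -> set sequentialization) :
  (forall i, seq_open (f i)) -> seq_open (\bigcup_i f i).
Proof.
move=> of_ u x uf ux [i _ fx]; apply: (of_ i u x) => // n fn.
by apply: (uf n); exists i.
Qed.

HB.instance Definition _ := Choice.on sequentialization.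
HB.instance Definition _ := isOpenTopological.Build sequentialization
  seq_openT seq_openI seq_open_bigU.

Definition cl_seq (A : set X) : set X := closure (A : set sequentialization).

End SequentialModification.

Section StronglySequential.
Context (X : topologicalType).

(* filter_from B id is the family of all supersets of members of B. *)
Definition countably_based (H : set_system X) : Prop :=
  exists2 B : set_system X, countable B & H = filter_from B id.

Definition adherence (H : set_system X) : set X := \bigcap_(A in H) closure A.

(* u @ \oo is the filter generated by the tails of u, so the first condition
   says that every tail of u meets every member of H. *)
Definition adherence_seq (H : set_system X) : set X :=
  [set x | exists2 u : nat -> X, (u @ \oo) `#` H & u @ \oo --> x].

Definition strongly_sequential : Prop :=
  accessible_space X /\
  forall H : set_system X, ProperFilter H -> countably_based H ->
    adherence H `<=` cl_seq (adherence_seq H).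

End StronglySequential.

(* Main.v *)
(* Let U_n be a decreasing base of neighbourhoods of 0 in G. The polars of the
   U_n are compact, and every convergent sequence of the dual has a tail in one
   of them. So if no polar were a neighbourhood of 0, the filter generated by
   their complements would adhere to 0 and have no sequential adherence at all,
   contradicting strong sequentiality. Hence the dual is locally compact.

   For first countability, strong sequentiality applied to principal filters
   gives countable tightness. By an argument of Shapirovskii, a point of a
   locally compact, countably tight space has a countable pi-base: otherwise
   there would be a free sequence of length omega_1. If (O_n) is a countable
   pi-base at 0, the sets O_n - O_n form a base at 0, and a translation
   invariant metric is then written down explicitly. *)
Require Import Defs.
From HB Require Import structures.
From mathcomp Require Import all_boot all_order all_algebra.
From mathcomp Require wochoice.
From mathcomp Require Import complex finmap ring lra.
From mathcomp Require Import all_classical all_reals all_analysis.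

Set Implicit Arguments.
Unset Strict Implicit.
Unset Printing Implicit Defensive.

Import Order.TTheory GRing.Theory Num.Theory.
Import numFieldNormedType.Exports.
Import ComplexField.Normc.

Local Open Scope classical_set_scope.
Local Open Scope ring_scope.

(** * The distance on the torus *)

Section TorusDistance.
Context (R : realType).
Implicit Types z w t : torus R.

(** Chordal distance on the unit circle; [normc] gives it values in [R], whereas the norm of [R[i]]
    is complex-valued. *)
Definition torus_dist z w : R := normc ((set_val z : R[i]) - set_val w).

Lemma torus_dist_ge0 z w : 0 <= torus_dist z w.
Proof. by rewrite /torus_dist /normc; case: (_ - _) => a b; exact: sqrtr_ge0. Qed.

Lemma torus_dist_refl z : torus_dist z z = 0.
Proof. by rewrite /torus_dist subrr normc0. Qed.

Lemma torus_dist_eq0 z w : torus_dist z w = 0 -> z = w.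
Proof. by move=> /eq0_normc/eqP; rewrite subr_eq0 => /eqP/val_inj. Qed.

Lemma torus_distC z w : torus_dist z w = torus_dist w z.
Proof. by rewrite /torus_dist -normcN opprB. Qed.

Lemma torus_dist_triangle t z w :
  torus_dist z w <= torus_dist z t + torus_dist t w.
Proof.
rewrite /torus_dist (_ : set_val z - set_val w =
  (set_val z - set_val t) + (set_val t - set_val w)); first exact: le_normcD.
by rewrite addrA subrK.
Qed.

Lemma normc_torus z : normc (set_val z : R[i]) = 1.
Proof.
have := torus_norm z; rewrite (_ : `|_| = (normc (set_val z : R[i]))%:C%C) //.
by move=> /(congr1 (@complex.Re R)).
Qed.

Lemma torus_distDr t z w : torus_dist (z + t) (w + t) = torus_dist z w.
Proof. by rewrite /torus_dist /= -mulrBl normcM normc_torus mulr1. Qed.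

(** The order of [R[i]] only compares numbers with equal imaginary part, so a positive radius is
    real. *)
Let ball_torus z w (e : R[i]^o) : 0 < e ->
  ball (set_val z : R[i]^o) e (set_val w) <-> torus_dist z w < complex.Re e.
Proof. by rewrite /ball /= !ltcE => /andP[/= /eqP -> e0]; rewrite eqxx. Qed.

Lemma nbhs_torus z :
  nbhs z = filter_from [set e : R | 0 < e]
             (fun e => [set w | torus_dist z w < e]).
Proof.
apply/seteqP; split => A.
  rewrite nbhsE => -[B [[C oC <-] Cz] CA].
  have /nbhs_ballP[e e0 eC] := open_nbhs_nbhs (conj oC Cz).
  exists (complex.Re e); first by move: e0; rewrite /= ltcE => /andP[].
  by move=> w /(ball_torus _ _ e0)/eC/CA.
case=> r /= r0 rA; pose e : R[i]^o := r%:C%C.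
have e0 : 0 < e by rewrite ltcE eqxx.
apply: (@filterS _ (nbhs z) _ (set_val @^-1` ball (set_val z : R[i]^o) e)).
  by move=> w /(ball_torus _ _ e0)/rA.
have := nbhsx_ballx (set_val z : R[i]^o) e e0.
rewrite !nbhsE => -[C [oC Cz] CB].
exists (set_val @^-1` C); last exact: preimage_subset.
by split => //; exists C.
Qed.

Lemma torus_cvgP (T : Type) (F : set_system T) (f : T -> torus R) z :
  Filter F ->
  f @ F --> z <-> forall e : R, 0 < e -> \forall x \near F, torus_dist z (f x) < e.
Proof.
move=> FF; rewrite /cvg_to /= nbhs_torus; split=> [h e e0|h A [e e0 eA]].
  by apply: (h [set w | torus_dist z w < e]); exists e.
by apply: filterS (h e e0) => x /eA.
Qed.

(* |z^2 - 1| = |z - 1| |z + 1|, and |z + 1| >= 2 - |z - 1| >= 3/2. *)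
Lemma torus_dist_double z : torus_dist z 0 <= 1 / 2 ->
  torus_dist z 0 <= 2 / 3 * torus_dist (z + z) 0.
Proof.
rewrite /torus_dist /=; set u : R[i] := set_val z => z1.
have -> : u * u - 1 = (u - 1) * (u + 1) by ring.
rewrite normcM.
have n2 : normc (2 : R[i]) = 2.
  by rewrite -[2 in LHS]/(1 *+ 2) normcMn normc1.
have : normc (2 : R[i]) <= normc (u + 1) + normc (u - 1).
  rewrite -[normc (u - 1)]normcN.
  have -> : (2 : R[i]) = (u + 1) + - (u - 1) by ring.
  exact: le_normcD.
rewrite n2 => h.
have p : 0 <= normc (u - 1) by exact: (torus_dist_ge0 z 0).
nra.
Qed.

Let circle_subproof (x : R) : `|(cos x +i* sin x)%C| = 1 :> R[i].
Proof. by rewrite normc_def /= cos2Dsin2 sqrtr1. Qed.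

Let circle (x : R) : torus R := torus_of (circle_subproof x).

Let circle_continuous : continuous circle.
Proof.
move=> x; apply/torus_cvgP => e e0.
have e2 : 0 < e / 2 by rewrite divr_gt0.
have /cvgrPdist_lt/(_ _ e2) hc := @continuous_cos R x.
have /cvgrPdist_lt/(_ _ e2) hs := @continuous_sin R x.
near=> y; rewrite /torus_dist /=.
rewrite -[ltLHS]/(normc ((cos x - cos y) +i* (sin x - sin y))%C).
have -> : ((cos x - cos y) +i* (sin x - sin y))%C =
    (cos x - cos y)%:C%C + (0 +i* (sin x - sin y))%C.
  by apply/eqP; rewrite eq_complex /= addr0 add0r !eqxx.
apply: le_lt_trans (le_normcD _ _) _.
rewrite /= expr0n /= addr0 add0r !sqrtr_sqr [e]splitr ltrD//.
  by near: y; exact: hc.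
by near: y; exact: hs.
Unshelve. all: by end_near. Qed.

(** The torus is the image of a segment under the angle map; the sign of the imaginary part decides
    between [acos a] and [- acos a]. *)
Lemma torus_compact : compact [set: torus R].
Proof.
suff -> : [set: torus R] = circle @` `[- pi, pi].
  apply: continuous_compact; last exact: segment_compact.
  by apply: continuous_subspaceT => x; exact: circle_continuous.
apply/esym; rewrite -subTset => z _.
have := normc_torus z; case Ez : (set_val z : R[i]) => [a b] /= n1.
have ab : a ^+ 2 + b ^+ 2 = 1.
  by rewrite -[LHS]sqr_sqrtr ?n1 ?expr1n// addr_ge0 ?sqr_ge0.
have a1 : -1 <= a <= 1.
  by apply/andP; split; nra.
have ac : cos (acos a) = a by rewrite acosK ?in_itv.
have as_ : sin (acos a) = `|b|.
  by rewrite sin_acos// -sqrtr_sqr; congr Num.sqrt; rewrite -ab addrAC subrr add0r.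
have ap := acos_lepi a1; have a0 := acos_ge0 a1.
have p0 := pi_ge0 R.
have [b0|b0] := leP 0 b.
  exists (acos a); last by apply/val_inj; rewrite /= ac as_ ger0_norm// -Ez.
  by rewrite /= in_itv /= ap andbT; lra.
exists (- acos a).
  by rewrite /= in_itv /= lerN2 ap /=; lra.
by apply/val_inj; rewrite /= cosN sinN ac as_ ltr0_norm// opprK -Ez.
Qed.

End TorusDistance.

(** * The first uncountable ordinal *)

(** Cantor's diagonal argument: [D] collects the codes of the sets that do not contain their own
    code. *)
Lemma uncountable_set_nat : ~ countable [set: set nat].
Proof.
case/countable_injP => f f_inj.
pose D := [set n | exists2 A : set nat, f A = n & ~ A n].
have [Df|nDf] := pselect (D (f D)); last by apply: (nDf); exists D.
by case: (Df) => A fA nA; apply: nA; rewrite (f_inj A D) ?inE// fA.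
Qed.

(* A copy of the first uncountable ordinal: an uncountable set of minimal order
   type in a well-ordered type. *)
Lemma exists_omega1 : exists (lt : set nat -> set nat -> Prop) (D : set (set nat)),
  [/\ well_founded lt, forall x y z, lt x y -> lt y z -> lt x z,
      forall x y, x = y \/ lt x y \/ lt y x, ~ countable D &
      forall a, D a -> countable [set b | lt b a]].
Proof.
have [r wr] := wochoice.well_ordering_principle (set nat : eqType).
have minP (A : set (set nat)) : A !=set0 ->
    exists2 z, A z & forall x, A x -> r z x.
  case=> x Ax; have [|z [[Az zA] _]] := wr (mem A); first by exists x; exact/mem_set.
  by exists z => [|y Ay]; [exact: set_mem Az|apply: zA; exact: mem_set].
have wc : wochoice.wo_chain r predT by move=> A _; exact: wr.
have r_anti x y : r x y -> r y x -> x = y.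
  by move=> xy yx; apply: (wochoice.wo_chain_antisymmetric wc) => //; rewrite xy yx.
have r_tot x y : r x y \/ r y x by apply/orP; exact: (wochoice.wo_chainW wc).
have r_refl x : r x x by case: (r_tot x x).
have r_trans x y z : r x y -> r y z -> r x z.
  move=> xy yz; have [|w] := minP [set x; y; z]; first by exists x; left; left.
  move=> [[|]|] -> h.
  - by apply: h; right.
  - by rewrite (r_anti x y) //; apply: h; left; left.
  - by rewrite -(r_anti y z yz) //; apply: h; left; right.
pose lt x y := r x y /\ x <> y.
have lt_trans x y z : lt x y -> lt y z -> lt x z.
  move=> [xy nxy] [yz nyz]; split; first exact: r_trans yz.
  by move=> xz; apply: nxy; apply: r_anti => //; rewrite xz.
have lt_tot x y : x = y \/ lt x y \/ lt y x.
  have [->|/eqP nxy] := eqVneq x y; first by left.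
  right; case: (r_tot x y) => h; [left|right]; split => //.
  by move=> yx; exact/nxy/esym.
have lt_wf : well_founded lt.
  suff : [set x | ~ Acc lt x] = set0.
    move=> e x; apply: contrapT => h.
    by have : [set x | ~ Acc lt x] x by []; rewrite e.
  apply/eqP/negPn/negP => /set0P/minP[z nz zmin]; apply: nz; constructor.
  move=> y [yz nyz]; apply: contrapT => /zmin zy; apply: nyz; exact: r_anti.
exists lt.
(* If some initial segment is uncountable, the one below the least such point serves; otherwise the
   whole type does. *)
have [[a na]|h] := pselect (exists a, ~ countable [set b | lt b a]).
  have [|m nm mmin] := minP [set a | ~ countable [set b | lt b a]]; first by exists a.
  exists [set b | lt b m]; split => // b [bm nbm].
  by apply: contrapT => /mmin mb; apply: nbm; exact: r_anti.
exists setT; split => //; first exact: uncountable_set_nat.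
by move=> a _; apply: contrapT => na; apply: h; exists a.
Qed.

(** [P a] receives a total function but reads only its values below [a], so the partial function
    supplied by [Fix] can be completed with the default [y0]. *)
Lemma wf_recursion (T Y : Type) (lt : T -> T -> Prop) (y0 : Y)
    (P : T -> (T -> Y) -> Y) : well_founded lt ->
  (forall a f g, (forall b, lt b a -> f b = g b) -> P a f = P a g) ->
  exists f : T -> Y, forall a, f a = P a f.
Proof.
move=> wf ext.
pose ex a (f : forall b, lt b a -> Y) : T -> Y := fun b =>
  if pselect (lt b a) is left h then f b h else y0.
pose F := Fix wf (fun=> Y) (fun a f => P a (ex a f)).
exists F => a; rewrite {1}/F Fix_eq; last first.
  move=> x f g fg; congr (P x (ex x _)).
  by apply: functional_extensionality_dep => b;
    apply: functional_extensionality_dep => h.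
by apply: ext => b ba; rewrite /ex; case: pselect.
Qed.

Lemma seq_max (T : eqType) (lt : T -> T -> Prop) (s : seq T) (x : T) :
  (forall x y z, lt x y -> lt y z -> lt x z) ->
  (forall x y, x = y \/ lt x y \/ lt y x) ->
  exists2 m, m \in x :: s & forall y, y \in x :: s -> y = m \/ lt y m.
Proof.
move=> tr tot; elim: s x => [|y s IH] x.
  by exists x; rewrite ?mem_head // => y; rewrite inE => /eqP; left.
have [m ms mmax] := IH y.
have [->|[xm|mx]] := tot x m.
- exists m; first by rewrite mem_head.
  by move=> z; rewrite inE => /predU1P[|/mmax]; [left|].
- exists m; first by rewrite inE ms orbT.
  by move=> z; rewrite inE => /predU1P[->|/mmax]; [right|].
- exists x; first by rewrite mem_head.
  move=> z; rewrite inE => /predU1P[->|/mmax[->|zm]]; [by left|by right|].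
  by right; exact: tr mx.
Qed.

(** * Countable tightness and pi-bases *)

Section CountableTightness.
Context (X : topologicalType).

Definition countably_tight : Prop := forall (A : set X) x, closure A x ->
  exists B, [/\ countable B, B `<=` A & closure B x].

Lemma cl_seq_smallest (A C : set X) : seq_closed C -> A `<=` C -> cl_seq A `<=` C.
Proof.
move=> C_closed AC; pose C' : set (sequentialization X) := C.
have /closure_id C'E : closed C'.
  rewrite -openC; suff : seq_open (~` C') by [].
  by rewrite /seq_open setCK.
have : closure (A : set (sequentialization X)) `<=` closure C' by exact: closureS.
by rewrite -C'E.
Qed.

(** Strong sequentiality is applied to the principal filter of [A]. The set [C] of points adherent
    to countable subsets of [A] is sequentially closed and contains every limit of a sequence
    meshing with [A], hence the whole closure of [A]. *)
Lemma strongly_sequential_tight : strongly_sequential X -> countably_tight.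
Proof.
move=> [_ sX] A x Ax.
pose C := [set y | exists B, [/\ countable B, B `<=` A & closure B y]].
have C_closed : seq_closed C.
  move=> u y /choice[B uB] uy.
  exists (\bigcup_n B n); split.
  - by apply: bigcup_countable => // n _; case: (uB n).
  - by move=> z [n _ Bz]; case: (uB n) => _ + _; exact.
  move=> V /nbhs_interior/uy[N _ NV].
  have [_ _ /(_ _ (NV N (leqnn N)))[z [Bz Vz]]] := uB N.
  by exists z; split=> //; exists N.
pose H : set_system X := filter_from [set A] id.
have H_filter : ProperFilter H.
  apply: filter_from_proper; last first.
    by move=> _ ->; have [y [Ay _]] := Ax setT filterT; exists y.
  apply: filter_from_filter; first by exists A.
  by move=> _ _ -> ->; exists A; rewrite ?setIid.
have H_countable : countably_based H by exists [set A] => //; exact: countable1.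
apply: (cl_seq_smallest C_closed) (sX H H_filter H_countable x _).
  move=> y [u uH uy]; exists (range u `&` A); split.
  - apply: sub_countable (subset_card_le (@subIsetl _ _ _)) _.
    exact: sub_countable (card_image_le _ _) (countableP _).
  - exact: subIsetr.
  move=> V Vy; have [| |z [[/= Vz [n _ un]] Az]] := uH (V `&` range u) A.
  - by apply: filterI; [exact: uy|exists 0%N => // n _ /=; exists n].
  - by exists A.
  by exists z; split=> //; split=> //; exists n.
by move=> B [_ -> /closureS]; exact.
Qed.

End CountableTightness.

(** * A countable pi-base at a point with a compact neighbourhood *)

Section PiBase.
Context (X : topologicalType) (p : X) (K : set X).
Hypotheses (X_tight : countably_tight X) (X_regular : regular_space X).
Hypotheses (K_nbhs : nbhs p K) (K_compact : compact K).

(* Otherwise one builds, along omega_1, open sets [A b] around [p] and [B b]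
   with disjoint closures such that [B b] meets every nonempty finite
   intersection of the sets chosen before [b]. By compactness there are points
   [x c] in the closures of all [A b], b <= c, and all [B b], b > c. A cluster
   point [y] of the sequence [x] is in the closure of all its tails, hence in the
   closure of every [A b], and by tightness in the closure of some initial
   segment, hence of some [B b]. *)
Lemma countable_pi_base : exists O : set (set X),
  [/\ countable O, forall U, O U -> open U /\ U !=set0 &
      forall V, nbhs p V -> exists2 U, O U & U `<=` V].
Proof.
apply: contrapT => no_pi_base.
have /choice[AB AB_spec] (O : set (set X)) : exists AB : set X * set X,
    countable O -> [/\ nbhs p AB.1 /\ open AB.1, open AB.2, closure AB.1 `<=` K,
      closure AB.1 `&` closure AB.2 = set0 &
      forall U, O U -> open U -> U !=set0 -> U `&` AB.2 !=set0].
  have [cO|] := pselect (countable O); last by exists (set0, set0).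
  have [V pV VO] : exists2 V, nbhs p V &
      forall U, O U -> open U -> U !=set0 -> ~ U `<=` V.
    apply: contrapT => h; apply: no_pi_base.
    exists (O `&` [set U | open U /\ U !=set0]); split.
    - exact: sub_countable (subset_card_le (@subIsetl _ _ _)) cO.
    - by move=> U [].
    move=> V pV; apply: contrapT => h'; apply: h; exists V => // U OU oU U0 UV.
    by apply: h'; exists U.
  (* Shrinking twice puts [closure Z] inside the interior of [W] and [closure W] inside [V]. The
     complement of [closure W] then meets every nonempty open member of [O], since none lies in
     [V]. *)
  have [W pW clW] := X_regular (filterI pV K_nbhs).
  have [Z pZ clZ] := X_regular (nbhs_interior pW).
  exists (Z°, ~` closure W) => _ /=; split.
  - by split; [exact: nbhs_interior|exact: open_interior].
  - exact/closed_openC/closed_closure.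
  - move=> x /(closureS (@interior_subset _ _))/clZ/interior_subset/subset_closure.
    by move/clW => [].
  - rewrite -subset0 => x [/(closureS (@interior_subset _ _))/clZ Wx].
    move=> /(_ _ Wx)[y [nWy Wy]].
    by apply: nWy; exact: subset_closure.
  move=> U OU oU U0; apply: contrapT => h; apply: (VO U) => // x Ux.
  suff /clW[] : closure W x by [].
  by apply: contrapT => nWx; apply: h; exists x.
have [lt [D [lt_wf lt_trans lt_tot D_uncountable D_init]]] := exists_omega1.
have lt_irr b : ~ lt b b.
  by elim/(well_founded_ind lt_wf): b => b IH bb; exact: (IH b bb bb).
(* The boolean selects the second set of a pair when true; [fam a F] consists of the finite
   intersections of sets chosen before [a]. *)
pose side (F : set nat -> set X * set X) (i : set nat * bool) :=
  if i.2 then (F i.1).2 else (F i.1).1.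
pose fam a F := finI_from [set i : set nat * bool | lt i.1 a] (side F).
have [|F FE] :=
    @wf_recursion _ _ lt (set0, set0) (fun a F => AB (fam a F)) lt_wf.
  move=> a f g fg; congr AB; rewrite /fam; apply/seteqP; split.
    move=> _ [N Na <-]; exists N => //; apply: eq_bigcapr => i /Na.
    by rewrite inE /side => /= /fg ->.
  move=> _ [N Na <-]; exists N => //; apply: eq_bigcapr => i /Na.
  by rewrite inE /side => /= /fg ->.
have F_spec a : D a -> [/\ nbhs p (F a).1 /\ open (F a).1, open (F a).2,
    closure (F a).1 `<=` K, closure (F a).1 `&` closure (F a).2 = set0 &
    forall U, fam a F U -> open U -> U !=set0 -> U `&` (F a).2 !=set0].
  move=> Da; rewrite FE; apply: AB_spec; apply: finI_from_countable.
  have -> : [set i | lt i.1 a] = [set b | lt b a] `*` [set: bool].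
    by apply/seteqP; split=> [[b c]|[b c] []].
  by apply: countableX; [exact: D_init|exact: countableP].
(* [S c] takes the neighbourhoods of [p] up to the index [c] and the opposite sets after it. *)
pose S c b := side F (b, `[<lt c b>]).
(* Induction on the size of [N], with greatest element [m]. If [m] is not above [c], all the sets
   contain [p]; otherwise the sets other than [S c m] have a nonempty open intersection, a member of
   [fam m F], which [S c m] meets. *)
have S_finI c : finI D (S c).
  move=> N; have [n] := ubnP #|` N|.
  elim: n N => // n IH N Nn ND.
  have [N0|[b0 b0N]] := fset_0Vmem N.
    by exists p => b; rewrite /= N0 inE.
  have [s sE] : exists s, enum_fset N = s :: behead (enum_fset N).
    move: b0N; rewrite -[b0 \in N]/(b0 \in enum_fset N).
    by case: enum_fset => // s l _; exists s.
  have [m] := seq_max (behead (enum_fset N)) s lt_trans lt_tot.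
  rewrite -sE => mN mmax.
  have oS b : D b -> open (S c b).
    by move=> /F_spec[[_ oA] oB _ _ _]; rewrite /S /side /=; case: ifP.
  have Dm : D m by apply/set_mem/ND.
  have [cm|ncm] := pselect (lt c m); last first.
    exists p => b /= bN.
    have Db : D b by apply/set_mem/ND.
    have [[pA _] _ _ _ _] := F_spec b Db.
    rewrite /S /side /= asboolF; first exact: nbhs_singleton.
    move=> cb; apply: ncm; have [<- //|bm] := mmax b bN.
    exact: lt_trans bm.
  have [||x xS] := IH (N `\ m)%fset.
  - by move: Nn; rewrite (cardfsD1 m) mN.
  - by move=> b; rewrite !inE => /andP[_ /ND]; rewrite inE.
  have [_ _ _ _ Fm] := F_spec m Dm.
  have [|||y [yS yB]] := Fm (\bigcap_(b in [set` (N `\ m)%fset]) S c b).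
  - exists [fset (b, `[<lt c b>]) | b in (N `\ m)%fset]%fset.
      move=> i /imfsetP[b /= bN' ->].
      have [bm bN] : b <> m /\ b \in N by move: bN'; rewrite !inE => /andP[/eqP].
      by apply/mem_set => /=; case: (mmax b bN).
    rewrite predeqE => z; split=> h.
      move=> b /= bN; apply: (h (b, `[<lt c b>])) => /=.
      by apply/imfsetP; exists b.
    by move=> i /= /imfsetP[b /= bN ->]; exact: h.
  - rewrite openE => z zS; apply: filter_bigI => b bN.
    apply: open_nbhs_nbhs; split; last exact: zS.
    by apply/oS/set_mem/ND; move: bN; rewrite !inE => /andP[].
  - by exists x.
  exists y => b /= bN; have [->|/eqP bm] := eqVneq b m.
    by rewrite /S /side /= asboolT.
  by apply: yS; rewrite /= !inE bN andbT; apply/eqP.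
have /choice[x xS] (c : set nat) : exists x, D c ->
    forall b, D b -> closure (S c b) x.
  have [Dc|nDc] := pselect (D c); last by exists p.
  have S_filter := finI_filter (S_finI c).
  have ScK : closure (S c c) `<=` K.
    by have [_ _ + _ _] := F_spec c Dc; rewrite /S /side /= asboolF.
  have [|x [_ xS]] := K_compact S_filter.
    exists (S c c); first exact: finI_from1.
    by move=> z /subset_closure/ScK.
  exists x => _ b Db; move: xS; rewrite clusterE; apply.
  by exists (S c b) => //; exact: finI_from1.
have [d Dd] : D !=set0.
  by apply/set0P/negP => /eqP D0; apply: D_uncountable; rewrite D0.
pose tail a := [set x b | b in [set b | D b /\ ~ lt b a]].
have tail_filter : ProperFilter (filter_from D tail).
  apply: filter_from_proper => [|a Da]; last by exists (x a), a.
  apply: filter_from_filter; first by exists d.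
  have tailS a b : lt a b -> tail b `<=` tail a.
    move=> ab _ [c [Dc cb] <-]; exists c => //; split => // ca; apply: cb.
    exact: lt_trans ab.
  move=> a b Da Db; have [->|[ab|ba]] := lt_tot a b.
  - by exists b; rewrite ?setIid.
  - by exists b => // z bz; split => //; exact: tailS bz.
  - by exists a => // z az; split => //; exact: tailS az.
have xK b : D b -> K (x b).
  move=> Db; have [_ _ AK _ _] := F_spec b Db; apply: AK.
  by have := xS b Db b Db; rewrite /S /side /= asboolF.
have [|y [_]] := K_compact tail_filter.
  by exists d => // _ [b [Db _] <-]; exact: xK.
rewrite clusterE => y_tail.
have [|C [C_countable CD Cy]] := X_tight (A := x @` D) (x := y).
  have : closure (tail d) y by apply: y_tail; exists d.
  by apply: closureS => _ [b [Db _] <-]; exists b.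
have /choice[j jC] z : exists b, C z -> D b /\ x b = z.
  by have [/CD[b Db <-]|nCz] := pselect (C z); [exists b|exists d].
(* A countable set of indices is bounded in [D], which otherwise would be covered by countably many
   countable initial segments. The boolean adds the endpoint [j z] to the segment below it. *)
have [a Da Ca] : exists2 a, D a & forall z, C z -> lt (j z) a.
  apply: contrapT => h; apply: D_uncountable.
  apply: (@sub_countable _ _ _ (\bigcup_(z in C) \bigcup_c
      if c then [set b | lt b (j z)] else [set j z])).
    apply: subset_card_le => b Db; apply: contrapT => nb; apply: h; exists b => // z Cz.
    have [e|[//|bz]] := lt_tot (j z) b; exfalso; apply: nb; exists z => //.
      by exists false.
    by exists true.
  apply: bigcup_countable => // z Cz; apply: bigcup_countable => // -[] _.
    by have [/D_init] := jC z Cz.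
  exact: countable1.
have [_ _ _ AB0 _] := F_spec a Da.
(* Indices from [a] on give points in the closure of the first set of [F a], indices below [a]
   points in the closure of the second. *)
suff : (set0 : set X) y by [].
rewrite -AB0; split.
  have : closure (tail a) y by apply: y_tail; exists a.
  rewrite [X in _ -> X y](proj1 (closure_id _)); last exact: closed_closure.
  apply: closureS => _ [b [Db ba] <-].
  by have := xS b Db a Da; rewrite /S /side /= asboolF.
move: Cy; rewrite [X in _ -> X y](proj1 (closure_id _)); last exact: closed_closure.
apply: closureS => z Cz; have [Dz <-] := jC z Cz.
by have := xS (j z) Dz a Da; rewrite /S /side /= asboolT //; exact: Ca.
Qed.

End PiBase.

(** * Uniform convergence on compact sets *)

Lemma torus_ball_nbhs (R : realType) (z : torus R) (e : R) : 0 < e ->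
  nbhs z [set w | torus_dist w z < e].
Proof.
by move=> e0; rewrite nbhs_torus; exists e => // w /=; rewrite torus_distC.
Qed.

Lemma torus_ball_open (R : realType) (z : torus R) (e : R) :
  open [set w | torus_dist w z < e].
Proof.
rewrite openE => w /= wz; rewrite /interior nbhs_torus.
exists (e - torus_dist w z) => /=; first by rewrite subr_gt0.
move=> v /=; rewrite ltrBrDr torus_distC.
exact: le_lt_trans (torus_dist_triangle _ _ _).
Qed.

(** Compactness in near-covering form, the parameter being a radius that tends to 0 from the
    right. *)
Lemma compact_image_margin (R : realType) (T : topologicalType)
    (f : T -> torus R) (K : set T) (O : set (torus R)) :
  continuous f -> compact K -> open O -> f @` K `<=` O ->
  exists2 e : R, 0 < e &
    forall x, K x -> forall w, torus_dist w (f x) < e -> O w.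
Proof.
move=> fc Kc oO fKO.
pose P (e : R) x := 0 < e /\ forall w, torus_dist w (f x) < e -> O w.
have KP : \forall e \near (0 : R)^'+, K `<=` P e.
  apply: ((compact_near_coveringP K).1 Kc) => x Kx.
  have : nbhs (f x) O by apply: open_nbhs_nbhs; split => //; apply: fKO; exists x.
  rewrite nbhs_torus => -[e /= e0 eO].
  have e2 : 0 < e / 2 by rewrite divr_gt0.
  exists ([set y | torus_dist (f y) (f x) < e / 2], [set r : R | 0 < r /\ r < e / 2]).
    split; first exact: (fc x _ (torus_ball_nbhs (f x) e2)).
    near=> r; split; near: r; [exact: nbhs_right_gt|exact: nbhs_right_lt].
  move=> [y r] /= [yx [r0 re]]; split => // w wy; apply: eO => /=.
  rewrite torus_distC (le_lt_trans (torus_dist_triangle (f y) _ _))//.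
  by rewrite [e]splitr ltrD // (lt_trans wy).
have [e eP] := @filter_ex _ _ (at_right_proper_filter (0 : R)) _ KP.
(* Positivity of [e] is read off at a point of [K]; for empty [K] the radius 1 is a default. *)
have [[x Kx]|K0] := pselect (K !=set0).
  by have [e0 _] := eP x Kx; exists e => // y /eP[].
by exists 1 => // x Kx; exfalso; apply: K0; exists x.
Unshelve. all: by end_near. Qed.

Section Dual.
Context (R : realType) (G : topologicalZmodType).
Implicit Types (f g h : dual R G) (C : set G).

Definition unif_ball C (e : R) f : set (dual R G) :=
  [set g | forall x, C x -> torus_dist (dual_fun g x) (dual_fun f x) < e].

(** Together with [unif_ball_nbhs], this identifies the topology of the dual with uniform
    convergence on compact sets. By [compact_image_margin], the filter [F] of uniform neighbourhoods
    converges to [f] in the compact-open topology. *)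
Lemma nbhs_dual_sub f (A : set (dual R G)) : nbhs f A ->
  exists C e, [/\ compact C, 0 < e & unif_ball C e f `<=` A].
Proof.
rewrite nbhsE => -[_ [[B oB <-] /= Bf] BA].
pose F : set_system {compact-open, G -> torus R} :=
  filter_from [set Ce : set G * R | compact Ce.1 /\ 0 < Ce.2]
    (fun Ce => [set g | forall x, Ce.1 x -> torus_dist (g x) (dual_fun f x) < Ce.2]).
have F_filter : Filter F.
  apply: filter_from_filter; first by exists (set0, 1) => /=; split=> //; exact: compact0.
  move=> [C e] [C' e'] /= [cC e0] [cC' e'0].
  exists (C `|` C', Num.min e e') => /=.
    by split; [exact: compactU|rewrite lt_min e0].
  move=> g /= gh; split => x Cx.
    by have := gh x (or_introl Cx); rewrite lt_min => /andP[].
  by have := gh x (or_intror Cx); rewrite lt_min => /andP[].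
have Ff : F --> (set_val f : {compact-open, G -> torus R}).
  apply/compact_open_cvgP => K O cK oO fKO.
  have [e e0 eO] := compact_image_margin (@dual_continuous _ _ f) cK oO fKO.
  by exists (K, e) => // g /= gK _ [x Kx <-]; exact: eO (gK x Kx).
have [[C e] /= [cC e0] CB] : F B by apply: Ff; exact: open_nbhs_nbhs.
exists C, e; split=> // g gC; apply: BA => /=; exact: CB.
Qed.

(** Near a point [x] of [C], [f] varies by less than [e / 4] on [V], hence by less than [e / 2] on
    [closure V]. Sending the compact part of [C] in [closure V] into the ball of radius [e / 2]
    about [f x] is an open condition on [g], and it keeps [g] within [e / 2 + e / 4] of [f] on the
    part of [C] in [V]. *)
Lemma unif_ball_nbhs C (e : R) f : compact C -> 0 < e ->
  nbhs f (unif_ball C e f).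
Proof.
move=> cC e0.
have e2 : 0 < e / 2 by rewrite divr_gt0.
have e4 : 0 < e / 4 by rewrite divr_gt0.
pose P g x := torus_dist (dual_fun g x) (dual_fun f x) < e.
suff : \forall g \near f, C `<=` P g by [].
have cover_C := (near_covering_withinP C).2 ((compact_near_coveringP C).1 cC).
apply: (cover_C _ (nbhs f) P).
move=> x Cx.
pose V := dual_fun f @^-1` [set w | torus_dist w (dual_fun f x) < e / 4].
have Vx : nbhs x V by exact: (dual_continuous (torus_ball_nbhs _ e4)).
pose O := [set w | torus_dist w (dual_fun f x) < e / 2].
have fVO : dual_fun f @` (C `&` closure V) `<=` O.
  move=> _ [y [_ Vy] <-].
  have [z [Vz /= zy]] := Vy _ (dual_continuous (torus_ball_nbhs (dual_fun f y) e4)).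
  rewrite /O /= (le_lt_trans (torus_dist_triangle (dual_fun f z) _ _))//.
  have -> : e / 2 = e / 4 + e / 4 by lra.
  by rewrite ltrD// torus_distC.
have cCV : compact (C `&` closure V).
  by apply: compact_closedI => //; exact: closed_closure.
pose W : set (dual R G) :=
  set_val @^-1` [set g : {compact-open, G -> torus R} | g @` (C `&` closure V) `<=` O].
have Wf : nbhs f W.
  apply: open_nbhs_nbhs; split => //; eexists; last by reflexivity.
  by apply: compact_open_open => //; exact: torus_ball_open.
exists (V, W) => // -[y g] /= [Vy Wg] Cy.
have gy : torus_dist (dual_fun g y) (dual_fun f x) < e / 2.
  by apply: Wg; exists y => //; split => //; exact: subset_closure.
rewrite /P (le_lt_trans (torus_dist_triangle (dual_fun f x) _ _))//.
rewrite [e]splitr ltrD// torus_distC (lt_trans Vy)//; lra.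
Qed.

Lemma unif_ball_sub C (e1 e2 : R) f g h : unif_ball C e1 f g ->
  unif_ball C e2 g h -> unif_ball C (e1 + e2) f h.
Proof.
move=> fg gh x Cx.
rewrite (le_lt_trans (torus_dist_triangle (dual_fun g x) _ _))//.
by rewrite addrC ltrD//; [exact: fg|exact: gh].
Qed.

Lemma unif_ball_sym C (e : R) f g : unif_ball C e f g -> unif_ball C e g f.
Proof. by move=> fg x Cx; rewrite torus_distC; exact: fg. Qed.

Lemma unif_ballD C (e : R) f g h :
  unif_ball C e f g -> unif_ball C e (f + h) (g + h).
Proof.
move=> fg x Cx; rewrite -[dual_fun (g + h) x]/(dual_fun g x + dual_fun h x).
by rewrite -[dual_fun (f + h) x]/(dual_fun f x + dual_fun h x) torus_distDr; exact: fg.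
Qed.

Lemma dual_regular : regular_space (dual R G).
Proof.
move=> f A /nbhs_dual_sub[C [e [cC e0 CA]]].
have e2 : 0 < e / 2 by rewrite divr_gt0.
exists (unif_ball C (e / 2) f); first exact: unif_ball_nbhs.
move=> g /(_ _ (unif_ball_nbhs g cC e2))[h [fh gh]]; apply: CA.
by rewrite [e]splitr; apply: unif_ball_sub fh _; exact: unif_ball_sym.
Qed.

Lemma dual_translation_continuous h : continuous (fun f => f + h).
Proof.
move=> f A /nbhs_dual_sub[C [e [cC e0 CA]]].
apply: filterS (unif_ball_nbhs f cC e0) => g fg.
by apply: CA; exact: unif_ballD.
Qed.

End Dual.

(** * Polars *)

Section Polar.
Context (R : realType) (G : topologicalZmodType).
Implicit Types (f g h : dual R G) (U C : set G).

(** The bound [1 / 2] is the one under which [torus_dist_double] applies; this makes polars of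
    neighbourhoods of 0 equicontinuous. *)
Definition polar U : set (dual R G) :=
  [set f | forall x, U x -> torus_dist (dual_fun f x) 0 <= 1 / 2].

Lemma dual_point_nbhs f x (e : R) : 0 < e ->
  nbhs f [set g | torus_dist (dual_fun g x) (dual_fun f x) < e].
Proof.
move=> e0; apply: filterS (unif_ball_nbhs f (@compact_set1 _ x) e0) => g.
by apply.
Qed.

Lemma polar_closed U : closed (polar U).
Proof.
move=> f Uf x Ux; apply/ler_addgt0Pr => e e0.
have [g [Ug /= gf]] := Uf _ (dual_point_nbhs f x e0).
rewrite (le_trans (torus_dist_triangle (dual_fun g x) _ _))// addrC lerD//.
  exact: Ug.
by rewrite torus_distC ltW.
Qed.

(* If x, 2 x, ..., 2^n x lie in U, then torus_dist_double applies n times. *)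
Lemma polar_small U (e : R) : nbhs (0 : G) U -> 0 < e ->
  exists2 V, nbhs (0 : G) V &
    forall f : G -> torus R, {morph f : x y / x + y} ->
      (forall x, U x -> torus_dist (f x) 0 <= 1 / 2) ->
      forall x, V x -> torus_dist (f x) 0 < e.
Proof.
move=> U0 e0.
have q0 : 0 <= 2 / 3 :> R by lra.
have small n : exists2 V, nbhs (0 : G) V &
    forall f : G -> torus R, {morph f : x y / x + y} ->
      (forall x, U x -> torus_dist (f x) 0 <= 1 / 2) ->
      forall x, V x -> torus_dist (f x) 0 <= (2 / 3) ^+ n.
  elim: n => [|n [V V0 fV]].
    exists U => // f fD fU x Ux; rewrite expr0 (le_trans (fU x Ux))//; lra.
  exists (U `&` (fun x => x + x) @^-1` V).
    apply: filterI => //.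
    have add_cvg : (fun x : G => x + x) @ 0 --> (0 : G) + 0.
      have addc := @add_continuous G ((0 : G), (0 : G)).
      exact: (@cvg_comp _ _ _ (fun x : G => (x, x)) _ _ _ _
        (cvg_pair cvg_id cvg_id) addc).
    by apply: add_cvg; rewrite addr0.
  move=> f fD fU x [Ux Vx]; rewrite exprS.
  apply: le_trans (torus_dist_double (fU x Ux)) _.
  by rewrite -fD ler_wpM2l//; exact: fV.
have q1 : `|2 / 3 : R| < 1 by rewrite ger0_norm//; lra.
have /cvgrPdist_lt/(_ e e0)[n _ qn] := cvg_expr q1.
have [V V0 fV] := small n; exists V => // f fD fU x Vx.
apply: le_lt_trans (fV f fD fU x Vx) _.
have := qn n (leqnn n); rewrite /= sub0r normrN ger0_norm//.
Qed.

Lemma nbhs_translate (x : G) (V : set G) : nbhs (0 : G) V ->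
  nbhs x [set y | V (y - x)].
Proof.
move=> V0.
have sub_cvg : (fun y : G => y - x) @ x --> x - x.
  have subc := @sub_continuous G (x, x).
  exact: (@cvg_comp _ _ _ (fun y : G => (y, x)) _ _ _ _
    (cvg_pair cvg_id (cvg_cst x)) subc).
by apply: sub_cvg; rewrite subrr.
Qed.

Lemma additive_sub (f : G -> torus R) : {morph f : x y / x + y} ->
  forall x y, torus_dist (f (x - y)) 0 = torus_dist (f x) (f y).
Proof.
move=> fD x y; have -> : f x = f (x - y) + f y by rewrite -fD subrK.
by rewrite -{2}[f y]add0r torus_distDr.
Qed.

(** An Arzela-Ascoli argument. Along an ultrafilter, pointwise limits exist because the torus is
    compact; they form an additive function bounded on [U]. Equicontinuity makes it continuous and
    the convergence uniform on compact sets. *)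
Lemma polar_compact U : nbhs (0 : G) U -> compact (polar U).
Proof.
move=> U0; rewrite compact_ultra => F F_ultra FU.
have /choice[f f_near] x : exists z : torus R, forall e : R, 0 < e ->
    \forall g \near F, torus_dist z (dual_fun g x) < e.
  have [|z [_ z_cluster]] := @torus_compact R ((fun g => dual_fun g x) @ F) _.
    by rewrite /= preimage_setT; exact: filterT.
  exists z => e e0.
  have [//|Fn] := in_ultra_setVsetC [set g | torus_dist z (dual_fun g x) < e] F_ultra.
  have [|w [/= nw zw]] :=
      z_cluster [set w | ~ torus_dist w z < e] _ _ (torus_ball_nbhs z e0).
    by apply: (@filterS _ F _ _ _ _ Fn) => g /= nz; rewrite torus_distC.
  by [].
have fD : {morph f : x y / x + y}.
  move=> x y; apply: torus_dist_eq0; apply/eqP; rewrite eq_le torus_dist_ge0 andbT.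
  apply/ler_addgt0Pr => e e0; rewrite add0r.
  have e3 : 0 < e / 3 by rewrite divr_gt0.
  have [g [[gx gy] gxy]] := filter_ex (filterI (filterI (f_near x _ e3) (f_near y _ e3))
    (f_near (x + y) _ e3)).
  have t1 := torus_dist_triangle (dual_fun g (x + y)) (f (x + y)) (f x + f y).
  have t2 := torus_dist_triangle (f x + dual_fun g y)
    (dual_fun g (x + y)) (f x + f y).
  rewrite [in X in _ <= X + _]dual_morph torus_distDr !(addrC (f x)) torus_distDr in t2.
  rewrite (torus_distC (dual_fun g y)) (torus_distC (dual_fun g x)) in t2.
  rewrite !(addrC (f x)) in t1 *.
  lra.
have fU x : U x -> torus_dist (f x) 0 <= 1 / 2.
  move=> Ux; apply/ler_addgt0Pr => e e0.
  have [g [gx gU]] := filter_ex (filterI (f_near x _ e0) FU).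
  rewrite (le_trans (torus_dist_triangle (dual_fun g x) _ _))// addrC lerD//.
    exact: gU.
  exact: ltW.
(* Stated for bare additive functions, so that it covers both [f], whose continuity is still to be
   shown, and the characters in the polar. *)
have equi (e : R) : 0 < e -> exists2 V, nbhs (0 : G) V & forall h : G -> torus R,
    {morph h : x y / x + y} -> (forall x, U x -> torus_dist (h x) 0 <= 1 / 2) ->
    forall x y, V (y - x) -> torus_dist (h y) (h x) < e.
  move=> /(polar_small U0)[V V0 VP]; exists V => // h hD hU x y Vxy.
  by rewrite -additive_sub//; exact: VP.
have fc : continuous f.
  move=> x; apply/torus_cvgP => e /equi[V V0 VP].
  apply: filterS (nbhs_translate x V0) => y /= Vyx.
  by rewrite torus_distC; exact: VP.
exists (dual_of fc fD); split; first exact: fU.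
move=> A /nbhs_dual_sub[C [e [cC e0 CA]]].
have e3 : 0 < e / 3 by rewrite divr_gt0.
have [V V0 VP] := equi _ e3.
apply: filterS CA _.
(* Each [e / 3] pays for one move: from [y] to [x] under [g], from [g] to [f] at [x], and from [x]
   back to [y] under [f]. *)
pose P g x := torus_dist (dual_fun g x) (f x) < e.
apply: ((compact_near_coveringP C).1 cC _ F P) => x Cx.
exists ([set y | V (y - x)],
    polar U `&` [set g | torus_dist (f x) (dual_fun g x) < e / 3]).
  by split; [exact: nbhs_translate|apply: filterI => //; exact: f_near].
move=> [y g] [/= Vyx [gU gx]]; rewrite /P.
have h1 := VP _ fD fU x y Vyx.
have h2 := VP _ (@dual_morph _ _ g) gU x y Vyx.
have h3 := torus_dist_triangle (dual_fun g x) (dual_fun g y) (f y).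
have h4 := torus_dist_triangle (f x) (dual_fun g x) (f y).
rewrite (torus_distC (f x)) in gx; rewrite (torus_distC (f x)) in h4.
lra.
Qed.

End Polar.

(** * Local compactness and first countability of the dual *)

(** An ultrafilter that does not converge to [x] omits a neighbourhood of [x], so it lives on the
    finitely many terms outside it. *)
Lemma compact_cvg_range (T : topologicalType) (u : nat -> T) (x : T) :
  u @ \oo --> x -> compact ([set x] `|` range u).
Proof.
move=> ux; rewrite compact_ultra => F F_ultra Fu.
have [Fx|nFx] := pselect (F --> x); first by exists x; split => //; left.
have [V Vx nFV] : exists2 V, nbhs x V & ~ F V.
  by apply: contrapT => h; apply: nFx => V Vx; apply: contrapT => FV; apply: h; exists V.
have [//|FnV] := in_ultra_setVsetC V F_ultra.
have [N _ uV] := ux V Vx.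
have : compact (u @` `I_N) by apply/finite_compact/finite_image/finite_II.
rewrite compact_ultra => /(_ F F_ultra)[|y [[n nN <-] Fy]].
  apply: filterS (filterI FnV Fu) => y [nV [yx|[n _ un]]].
    by case: nV; rewrite yx; exact: nbhs_singleton.
  exists n => //=; rewrite ltnNge; apply/negP => Nn; apply: nV.
  by rewrite -un; exact: uV.
by exists (u n); split => //; right; exists n.
Qed.

Section DualMetric.
Context (R : realType) (G : topologicalZmodType).
Implicit Types (f g h : dual R G) (U C : set G).

Lemma dual_eval0 f : dual_fun f 0 = 0.
Proof. by apply: (addrI (dual_fun f 0)); rewrite addr0 -dual_morph addr0. Qed.

Section CountableBase.
Variable U : nat -> set G.
Hypothesis U_decr : forall m n, (m <= n)%N -> U n `<=` U m.
Hypothesis U_base : forall V, nbhs (0 : G) V -> exists n, U n `<=` V.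

(* Points x n of U n on which u (k n), k n >= n, is far from 0 would form with 0
   a compact set, on which u converges uniformly to the continuous f. *)
Lemma cvg_dual_polar (u : nat -> dual R G) f : u @ \oo --> f ->
  exists n, \forall k \near \oo, polar (U n) (u k).
Proof.
move=> uf; apply: contrapT => h.
have /choice[kx kxP] n : exists kx : nat * G, [/\ (n <= kx.1)%N, U n kx.2 &
    1 / 2 < torus_dist (dual_fun (u kx.1) kx.2) 0].
  apply: contrapT => h'; apply: h; exists n; exists n => // k /= nk x Ux.
  by rewrite leNgt; apply/negP => hx; apply: h'; exists (k, x).
pose x n := (kx n).2.
have x0 : x @ \oo --> (0 : G).
  move=> V /U_base[n UV]; exists n => // m /= nm; apply/UV/(U_decr nm).
  by have [] := kxP m.
(* Near 0 the values of [f] are within [1 / 4] of 0, and [u] is eventually within [1 / 4] of [f] on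
   the compact set; the chosen points exceed the sum [1 / 2]. *)
have c4 : 0 < 1 / 4 :> R by lra.
have := uf _ (unif_ball_nbhs f (compact_cvg_range x0) c4).
move=> [N _ uN].
have fx : dual_fun f (0 : G) = 0 by exact: dual_eval0.
have f0 : nbhs (0 : torus R) [set w | torus_dist w 0 < 1 / 4] by exact: torus_ball_nbhs.
rewrite -[X in nbhs X]fx in f0.
have [M _ fM] := x0 _ (dual_continuous f0).
pose n := maxn N M; have [nk Ux] := kxP n.
have h1 := fM n (leq_maxr _ _).
have h2 : torus_dist (dual_fun (u (kx n).1) (x n)) (dual_fun f (x n)) < 1 / 4.
  apply: uN; first exact: leq_trans (leq_maxl _ _) nk.
  by right; exists n.
have h3 := torus_dist_triangle (dual_fun f (x n)) (dual_fun (u (kx n).1) (x n)) 0.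
rewrite /= in h1 *; rewrite -/(x n); lra.
Qed.

Lemma polar_nbhs : strongly_sequential (dual R G) ->
  exists n, nbhs (0 : dual R G) (polar (U n)).
Proof.
move=> [_ sG]; apply: contrapT => h.
pose B : set_system (dual R G) := range (fun n => ~` polar (U n)).
pose H : set_system (dual R G) := filter_from B id.
(* Serves for the adherence of [H] and, since a set adherent to 0 is nonempty, for properness. *)
have H0 A : H A -> closure A 0.
  move=> [_ [n _ <-] /closureS]; apply => V V0; apply: contrapT => VU.
  apply: h; exists n; apply: filterS V0 => f Vf; apply: contrapT => nf.
  by apply: VU; exists f.
have H_filter : ProperFilter H.
  apply: filter_from_proper; last first.
    by move=> A BA; have [|f [Af _]] := H0 A _ setT filterT; [exists A|exists f].
  apply: filter_from_filter; first by exists (~` polar (U 0%N)), 0%N.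
  move=> _ _ [m _ <-] [n _ <-]; exists (~` polar (U (maxn m n))).
    by exists (maxn m n).
  by move=> f nf; split => fU; apply: nf => x /U_decr Ux; apply: fU; apply: Ux;
    rewrite ?leq_maxl ?leq_maxr.
have H_countable : countably_based H.
  by exists B => //; exact: sub_countable (card_image_le _ _) (countableP _).
have H_adh : adherence_seq H `<=` set0.
  move=> f [u uH uf]; have [n un] := cvg_dual_polar uf.
  have [||g [gU]] := uH (polar (U n)) (~` polar (U n)) => //.
  by exists (~` polar (U n)) => //; exists n.
have closed0 : seq_closed (set0 : set (dual R G)) by move=> u x /(_ 0%N).
exact: (cl_seq_smallest closed0 H_adh (sG H H_filter H_countable 0 H0)).
Qed.

End CountableBase.

(** The neighbourhood of [f] is a translate of the polar: compact as an image, closed as a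
    preimage. *)
Lemma dual_locally_compact U : nbhs (0 : G) U ->
  nbhs (0 : dual R G) (polar U) -> locally_compact [set: dual R G].
Proof.
move=> U0 pU f _.
rewrite withinET; exists ((fun g => g + f) @` polar U).
  have f_nbhs : nbhs f [set g | polar U (g - f)].
    by apply: (@dual_translation_continuous _ _ (- f) f); rewrite subrr.
  by apply: (@filterS _ (nbhs f) _ _ _ _ f_nbhs) => g gU; exists (g - f); rewrite ?subrK.
split.
  apply: continuous_compact; last exact: polar_compact.
  by apply: continuous_subspaceT => g; exact: dual_translation_continuous.
have -> : (fun g => g + f) @` polar U = (fun g => g - f) @^-1` polar U.
  apply/seteqP; split=> [_ [g gU <-]|g gU]; rewrite /preimage /=; first by rewrite addrK.
  by exists (g - f) => //; rewrite subrK.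
apply: closed_comp; last exact: polar_closed.
by move=> g _; exact: dual_translation_continuous.
Qed.

(** If [W] contains a ball around one of its points, [W - W] contains the same ball around 0; if [W]
    lies in the ball of radius [e / 2] about 0, [W - W] lies in the one of radius [e]. So the balls
    found for the members of a countable pi-base form a base at 0. *)
Lemma dual_first_countable : strongly_sequential (dual R G) ->
  forall U, nbhs (0 : G) U -> nbhs (0 : dual R G) (polar U) ->
  exists (C : nat -> set G) (e : nat -> R),
    (forall n, compact (C n) /\ 0 < e n) /\
    forall V, nbhs (0 : dual R G) V -> exists n, unif_ball (C n) (e n) 0 `<=` V.
Proof.
move=> sG U U0 pU.
have [B [B_countable B_open B_base]] :=
  countable_pi_base (strongly_sequential_tight sG) (@dual_regular R G) pU
    (polar_compact U0).
have /countable_injP[i i_inj] := B_countable.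
have /choice[Ce CeP] n : exists Ce : set G * R, (compact Ce.1 /\ 0 < Ce.2) /\
    forall W, B W -> i W = n -> forall h, unif_ball Ce.1 Ce.2 0 h ->
      exists f g, [/\ W f, W g & h = f - g].
  (* Numbers that [i] gives to no member of the pi-base get a default ball. *)
  have [[W [OW Wn]]|h] := pselect (exists W, B W /\ i W = n); last first.
    exists (set0, 1); split; first by split => //=; exact: compact0.
    by move=> W OW Wn; exfalso; apply: h; exists W.
  have [oW [f Wf]] := B_open W OW.
  have [C [e [cC e0 CW]]] := nbhs_dual_sub (open_nbhs_nbhs (conj oW Wf)).
  exists (C, e); split=> // W' OW' W'n h hC.
  have -> : W' = W by apply: i_inj; rewrite ?inE// W'n.
  exists (h + f), f; split => //; last by rewrite addrK.
  by apply: CW; rewrite -[f in unif_ball _ _ f]add0r; exact: unif_ballD.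
exists (fun n => (Ce n).1), (fun n => (Ce n).2); split=> [n|].
  by case: (CeP n).
move=> V /nbhs_dual_sub[C [e [cC e0 CV]]].
have e2 : 0 < e / 2 by rewrite divr_gt0.
have [W OW WC] := B_base _ (unif_ball_nbhs 0 cC e2).
exists (i W) => h /((CeP (i W)).2 W OW erefl)[f [g [/WC Wf /WC Wg ->]]].
apply: CV => x Cx; rewrite -[dual_fun (f - g) x]/(dual_fun f x - dual_fun g x).
rewrite -(torus_distDr (dual_fun g x)) subrK add0r.
apply: le_lt_trans (torus_dist_triangle (dual_fun 0 x) _ _) _.
by rewrite [e]splitr ltrD//; [exact: Wf|rewrite torus_distC; exact: Wg].
Qed.

End DualMetric.

(** * Metrizability *)

Lemma min_subadditive (R : realDomainType) (a x y z : R) :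
  0 <= a -> 0 <= x -> 0 <= y -> z <= x + y ->
  Num.min a z <= Num.min a x + Num.min a y.
Proof.
by move=> a0 x0 y0 zxy; case: (leP a z); case: (leP a x); case: (leP a y); lra.
Qed.

Section CountableBaseMetric.
Context (R : realType) (G : topologicalZmodType).
Variables (C : nat -> set G) (e : nat -> R).
Hypothesis C_e : forall n, compact (C n) /\ 0 < e n.
Hypothesis C_base : forall V, nbhs (0 : dual R G) V ->
  exists n, unif_ball (C n) (e n) 0 `<=` V.
Implicit Types f g h : dual R G.

(* 0 is added so that the set is never empty. *)
Let D f g : set R := [set r | r = 0 \/ exists n x, C n x /\
  r = Num.min n.+1%:R^-1 (torus_dist (dual_fun f x) (dual_fun g x))].

(** Supremum of the distances on the sets [C n], truncated at [1 / (n + 1)] so that only finitely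
    many [n] matter for a given radius. *)
Let d f g : R := sup (D f g).

Let D_nonempty f g : D f g !=set0. Proof. by exists 0; left. Qed.

Let D_bounded f g : has_ubound (D f g).
Proof.
exists 1 => _ [->|[n [x [_ ->]]]]; first exact: ler01.
by rewrite ge_min invf_le1 ?ltr0n// ler1n.
Qed.

Let d_ge0 f g : 0 <= d f g.
Proof. by apply: (ub_le_sup (D_bounded f g)); left. Qed.

Let d_ge f g n x : C n x ->
  Num.min n.+1%:R^-1 (torus_dist (dual_fun f x) (dual_fun g x)) <= d f g.
Proof. by move=> Cx; apply: (ub_le_sup (D_bounded f g)); right; exists n, x. Qed.

Let dC f g : d f g = d g f.
Proof.
congr sup; apply/seteqP.
by split=> _ [->|[n [x [Cx ->]]]]; [left|right; exists n, x; rewrite torus_distC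
                                   |left|right; exists n, x; rewrite torus_distC].
Qed.

Let d_triangle f g h : d f h <= d f g + d g h.
Proof.
apply: ge_sup => // _ [->|[n [x [Cx ->]]]]; first by rewrite addr_ge0.
apply: le_trans (lerD (d_ge f g Cx) (d_ge g h Cx)).
have t := torus_dist_triangle (dual_fun g x) (dual_fun f x) (dual_fun h x).
have t1 := torus_dist_ge0 (dual_fun f x) (dual_fun g x).
have t2 := torus_dist_ge0 (dual_fun g x) (dual_fun h x).
have n0 : 0 <= n.+1%:R^-1 :> R by rewrite invr_ge0.
exact: min_subadditive.
Qed.

(** Below [1 / (n + 1)] the truncation is inactive. *)
Let d_small f g n : d f g < Num.min n.+1%:R^-1 (e n) -> unif_ball (C n) (e n) f g.
Proof.
rewrite lt_min => /andP[dn de] x Cx; rewrite torus_distC.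
have := le_lt_trans (d_ge f g Cx) dn; rewrite gt_min ltxx /= => tn.
have := le_lt_trans (d_ge f g Cx) de; rewrite gt_min => /orP[ne|//].
exact: lt_trans ne.
Qed.

Let nbhs_d f : nbhs f = filter_from [set r : R | 0 < r] (fun r => [set g | d f g < r]).
Proof.
apply/seteqP; split=> A.
  move=> fA; have V0 : nbhs (0 : dual R G) [set h | A (h + f)].
    by apply: (@dual_translation_continuous _ _ f 0); rewrite add0r.
  have [n CV] := C_base V0.
  exists (Num.min n.+1%:R^-1 (e n)).
    by rewrite /= lt_min invr_gt0 ltr0n /=; case: (C_e n).
  move=> g /= /d_small fg; rewrite -(subrK f g); apply: CV.
  by rewrite -(subrr f); exact: unif_ballD.
case=> r /= r0 rA.
have r2 : 0 < r / 2 by rewrite divr_gt0.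
(* From [N] on, truncation alone keeps the terms below [r / 2]; the indices before [N] need finitely
   many uniform neighbourhoods. Halving [r] leaves room for the weak inequality given by the
   supremum. *)
have [N _ Nr] := near_infty_natSinv_lt (PosNum r2).
have : nbhs f (\bigcap_(n in [set` [fset val n | n in 'I_N]%fset])
    unif_ball (C n) (r / 2) f).
  by apply: filter_bigI => n _; apply: unif_ball_nbhs => //; case: (C_e n).
apply: (@filterS _ (nbhs f)) => g fg; apply: rA => /=.
apply: (@le_lt_trans _ _ (r / 2)); last lra.
apply: ge_sup => // _ [->|[n [x [Cx ->]]]]; first exact: ltW.
have [nN|Nn] := ltnP n N; last by rewrite ge_min (ltW (Nr n Nn)).
rewrite ge_min; apply/orP; right; rewrite torus_distC ltW//; apply: (fg n _ x Cx) => /=.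
by apply/imfsetP; exists (Ordinal nN).
Qed.

Lemma dual_metrizable : metrizable R (dual R G).
Proof.
exists d; split => // f g; split=> [fg|->]; last first.
  apply/eqP; rewrite eq_le d_ge0 andbT; apply: ge_sup => // _ [->//|[n [x [_ ->]]]].
  by rewrite torus_dist_refl ge_min lexx orbT.
(* [d f g = 0] puts [g] in every neighbourhood of [f], in particular in those given by evaluation at
   [x]. *)
apply/val_inj/funext => x; apply: torus_dist_eq0; apply/eqP.
rewrite eq_le torus_dist_ge0 andbT; apply/ler_addgt0Pr => r r0; rewrite add0r ltW//.
have := dual_point_nbhs f x r0; rewrite nbhs_d => -[s /= s0]; rewrite torus_distC; apply.
by rewrite /= fg.
Qed.

End CountableBaseMetric.

Theorem proposition4 (R : realType) (G : topologicalZmodType)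
    (hG : metrizable R G) (hdual : strongly_sequential (dual R G)) :
  metrizable R (dual R G) /\ locally_compact [set: dual R G].
Proof.
have [d [d_ge0 d_eq0 dC d_triangle nbhs_d]] := hG.
pose U n : set G := [set x | d 0 x < n.+1%:R^-1].
have U_nbhs n : nbhs (0 : G) (U n).
  by rewrite nbhs_d; exists n.+1%:R^-1 => //=; rewrite invr_gt0.
have U_decr m n : (m <= n)%N -> U n `<=` U m.
  move=> mn x /= /lt_le_trans; apply.
  by rewrite lef_pV2 ?posrE ?ltr0n// ler_nat.
have U_base V : nbhs (0 : G) V -> exists n, U n `<=` V.
  rewrite nbhs_d => -[r /= r0 rV].
  have [n _ nr] := near_infty_natSinv_lt (PosNum r0).
  by exists n => x /= /lt_trans xn; apply/rV/xn/nr => /=.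
have [n Un] := polar_nbhs U_decr U_base hdual.
have [C [e [C_e C_base]]] := dual_first_countable hdual (U_nbhs n) Un.
split; first exact: dual_metrizable C_e C_base.
exact: dual_locally_compact (U_nbhs n) Un.
Qed.
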